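(* Let $n\ge2$ and $\alpha>1$. For each of the following WARMs with $W(x)=x^\alpha$, the equilibrium $\vec 1/n=(1/n,\dots,1/n)$ is linearly stable if and only if the indicated strict inequality holds, and it is critical when equality holds in that inequality. (1) Uniform fixed-$m$ model, $m\in[n]$ ($p_A=\binom nm^{-1}$ if $|A|=m$ and $p_A=0$ otherwise): $$\alpha<\frac{m(n-1)}{n(m-1)}$$ (right-hand side read as $+\infty$ if $m=1$). (2) Bernoulli$(p)$ model, $p\in(0,1)$ ($p_A=p^{|A|}(1-p)^{n-|A|}/(1-(1-p)^n)$ for $A\neq\varnothing$, $p_\varnothing=0$): $$\alpha<\frac{1-(1-p)^n}{\sum_{m=2}^np^m(1-p)^{n-m}\frac{n^2}{m^2}\binom{n-2}{m-2}}.$$ (3) Star graph with $n$ edges ($p_{\{i\}}=\frac1{n+1}$ for each $i\in[n]$, $p_{[n]}=\frac1{n+1}$, and $p_A=0$ otherwise): $\alpha<n+1$.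
   Context: $[n]=\{1,\dots,n\}$ and $\Delta_n=\{\vec u\in\mathbb R^n:u_i\ge0,\ \sum_i u_i=1\}$. A WARM is the urn model in which at each time a random subset $A$ of the $n$ colours is chosen (i.i.d., with probability $p_A$), and then a colour $i\in A$ is selected with probability proportional to $W$(current number of balls of colour $i$) and a ball of that colour is added. For $\vec v\in\Delta_n$, $F(\vec v)_i=-v_i+\sum_{A\ni i}p_A\,\frac{v_i^\alpha}{\sum_{j\in A}v_j^\alpha}$ (with $0/0$ read as $0$). An equilibrium is a $\vec v\in\Delta_n$ with $F(\vec v)=\vec 0$. At an equilibrium $\vec v$, $\mathbf D(\vec v)$ is the $n\times n$ matrix with entries $D_{i,k}=\partial F(\vec v)_i/\partial v_k$, namely $D_{i,i}=-1+\alpha v_i^{\alpha-1}\sum_{A\ni i}p_A\frac{\sum_{j\in A}v_j^\alpha-v_i^\alpha}{(\sum_{j\in A}v_j^\alpha)^2}$ and, for $k\ne i$, $D_{i,k}=-\alpha v_k^{\alpha-1}v_i^\alpha\sum_{A\ni i,k}\frac{p_A}{(\sum_{j\in A}v_j^\alpha)^2}$. The equilibrium is linearly stable if all eigenvalues of $\mathbf D(\vec v)$ have negative real parts, linearly unstable if some eigenvalue has positive real part, and critical otherwise. *)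

(* Defs.v *)
From HB Require Import structures.
From mathcomp Require Export all_boot all_order all_algebra.
From mathcomp Require Export all_classical all_reals all_analysis.
From mathcomp Require Export complex.
From mathcomp Require Import ring.

Set Implicit Arguments.
Unset Strict Implicit.
Unset Printing Implicit Defensive.

Export Order.TTheory GRing.Theory Num.Theory.
Export numFieldNormedType.Exports.

Local Open Scope ring_scope.

Section Warm.
Variables (R : realType) (n : nat).
Implicit Types (p : {set 'I_n} -> R) (a : R) (v : 'rV[R]_n) (A : {set 'I_n}).

Definition in_simplex v : Prop :=
  (forall i, 0 <= v 0 i) /\ \sum_i v 0 i = 1.

Definition weight a v A : R := \sum_(j in A) v 0 j `^ a.

(* [p A] is the probability of drawing [A].  The conventions [0 `^ a = 0] for
   [a != 0] and [x / 0 = 0] give the reading of [0/0] as [0]. *)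
Definition drift p a v : 'rV[R]_n :=
  \row_i (- v 0 i
          + \sum_(A : {set 'I_n} | i \in A) p A * (v 0 i `^ a / weight a v A)).

Definition equilibrium p a v : Prop := in_simplex v /\ drift p a v = 0.

(* Written out explicitly because [powR] extends [x `^ a] to [x < 0] by a junk
   value, so that partial derivatives on the boundary of the simplex would not
   be meaningful; [jacobianP] identifies it with the matrix of partial
   derivatives of [drift] at vectors with positive entries. *)
Definition jacobian p a v : 'M[R]_n :=
  \matrix_(i, k)
    if i == k then
      -1 + a * v 0 i `^ (a - 1) *
        \sum_(A : {set 'I_n} | i \in A)
          p A * ((weight a v A - v 0 i `^ a) / weight a v A ^+ 2)
    else
      - (a * v 0 k `^ (a - 1) * v 0 i `^ a *
          \sum_(A : {set 'I_n} | (i \in A) && (k \in A))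
            p A / weight a v A ^+ 2).

Definition jacobian_eigenvalue p a v (z : R[i]) : Prop :=
  eigenvalue (map_mx (real_complex R) (jacobian p a v)) z.

Definition linearly_stable p a v : Prop :=
  forall z, jacobian_eigenvalue p a v z -> complex.Re z < 0.

Definition linearly_unstable p a v : Prop :=
  exists2 z, jacobian_eigenvalue p a v z & 0 < complex.Re z.

Definition critical p a v : Prop :=
  ~ linearly_stable p a v /\ ~ linearly_unstable p a v.

Definition barycenter : 'rV[R]_n := const_mx n%:R^-1.

Definition uniform_model (m : nat) A : R :=
  if #|A| == m then ('C(n, m)%:R)^-1 else 0.

Definition bernoulli_model (q : R) A : R :=
  if A == finset.set0 then 0
  else q ^+ #|A| * (1 - q) ^+ (n - #|A|) / (1 - (1 - q) ^+ n).

Definition star_model A : R :=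
  if (#|A| == 1%N) || (A == [set: 'I_n]%SET) then (n.+1%:R)^-1 else 0.

Definition uniform_threshold (m : nat) : \bar R :=
  if m == 1%N then +oo%E
  else ((m%:R * (n%:R - 1)) / (n%:R * (m%:R - 1)))%:E.

Definition bernoulli_threshold (q : R) : R :=
  (1 - (1 - q) ^+ n) /
  \sum_(2 <= m < n.+1)
    q ^+ m * (1 - q) ^+ (n - m) * (n%:R ^+ 2 / m%:R ^+ 2) * 'C(n - 2, m - 2)%:R.

Lemma is_derive_bigsum (I : Type) (r : seq I) (P : pred I) (f : I -> R -> R)
    (df : I -> R) (x : R) :
  (forall i, P i -> is_derive x 1 (f i) (df i)) ->
  is_derive x 1 (fun t => \sum_(i <- r | P i) f i t) (\sum_(i <- r | P i) df i).
Proof.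
move=> H; elim: r => [|i r IH].
  rewrite big_nil.
  under [X in is_derive _ _ X]eq_fun do rewrite big_nil.
  exact: is_derive_cst.
rewrite big_cons; under [X in is_derive _ _ X]eq_fun do rewrite big_cons.
case: ifP => // Pi; exact: is_deriveD (H _ Pi) IH.
Qed.

Lemma jacobianP p a v i k : (forall j, 0 < v 0 j) ->
  is_derive (v 0 k) 1
    (fun x => drift p a (\row_j if j == k then x else v 0 j) 0 i)
    (jacobian p a v i k).
Proof.
move=> v0.
pose u (x : R) : 'rV[R]_n := \row_j if j == k then x else v 0 j.
have uv : u (v 0 k) = v by apply/rowP => j; rewrite mxE; case: eqP => [->|].
have du1 j : is_derive (v 0 k) 1 (fun x => u x 0 j) (j == k)%:R.
  under [X in is_derive _ _ X]eq_fun do rewrite mxE.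
  by case: (j == k); [exact: is_derive_id | exact: is_derive_cst].
have du j : is_derive (v 0 k) 1 (fun x => u x 0 j `^ a)
    ((j == k)%:R * (a * v 0 k `^ (a - 1))).
  under [X in is_derive _ _ X]eq_fun do rewrite mxE.
  case: (j == k); rewrite ?mul1r ?mul0r; last exact: is_derive_cst.
  exact: is_derive1_powR.
have dS A : is_derive (v 0 k) 1 (fun x => weight a (u x) A)
    ((k \in A)%:R * (a * v 0 k `^ (a - 1))).
  have -> : (k \in A)%:R * (a * v 0 k `^ (a - 1)) =
     \sum_(j in A) (j == k)%:R * (a * v 0 k `^ (a - 1)).
    rewrite -mulr_suml; congr (_ * _).
    case: (boolP (k \in A)) => kA.
      rewrite (bigD1 k)//= eqxx big1 ?addr0// => j /andP[_ /negPf ->] //.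
    by rewrite big1// => j jA; case: eqP => // jk; rewrite -jk jA in kA.
  exact: is_derive_bigsum.
have S0 A : i \in A -> weight a v A != 0.
  move=> iA; rewrite gt_eqF// /weight (bigD1 i)//=.
  by rewrite ltr_pwDl ?powR_gt0// sumr_ge0// => j _; exact: powR_ge0.
pose dT A := p A * ((i == k)%:R * (a * v 0 k `^ (a - 1)) / weight a v A
   - v 0 i `^ a * ((k \in A)%:R * (a * v 0 k `^ (a - 1))) / weight a v A ^+ 2).
have dTP A : i \in A -> is_derive (v 0 k) 1
    (fun x => p A * (u x 0 i `^ a / weight a (u x) A)) (dT A).
  move=> iA.
  have S1 : weight a (u (v 0 k)) A != 0 by rewrite uv S0.
  have h1 := is_deriveV S1 (dS A).
  have h2 := is_deriveZ (p A) (is_deriveM (du i) h1).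
  apply: (is_derive_eq h2); rewrite uv /dT /GRing.scale /=.
  by field; exact: S0.
have hsum := is_derive_bigsum (index_enum _) dTP.
have h := is_deriveD (is_deriveN (du1 i)) hsum.
under [X in is_derive _ _ X]eq_fun do rewrite mxE.
apply: (is_derive_eq h).
rewrite mxE /dT; case: (eqVneq i k) => [ik|ik].
  congr (_ + _); rewrite mulr_sumr; apply: eq_bigr => A iA.
  rewrite -ik iA !mul1r; field; exact: S0.
rewrite oppr0 add0r mulr_sumr -sumrN big_mkcondr/=; apply: eq_bigr => A iA.
by rewrite /= !mul0r; case: (k \in A); rewrite ?mul1r ?mul0r; field; exact: S0.
Qed.

End Warm.

Arguments barycenter : clear implicits.
Arguments uniform_model : clear implicits.
Arguments bernoulli_model : clear implicits.
Arguments star_model : clear implicits.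
Arguments uniform_threshold : clear implicits.
Arguments bernoulli_threshold : clear implicits.

(* Main.v *)
(* At the barycenter of an exchangeable model ([p A] depends on [#|A|] only), all
   [v_j ^ a] equal the same constant, and by symmetry the Jacobian is
   [(-1 + a n^2 T) I - a n T J] with [J] the all-ones matrix and
   [T = sum_(A containing i, k) p A / #|A|^2] for any [i != k].  Its eigenvalues are
   [-1], on the constant vectors, and [-1 + a n^2 T], on the vectors of sum zero;
   so stability amounts to [a n^2 T < 1], and [T] is a sum over [m = #|A|]
   weighted by the number ['C(n - 2, m - 2)] of sets containing [i] and [k]. *)
Require Import Defs.
From mathcomp Require Import ring lra.

Set Implicit Arguments.
Unset Strict Implicit.
Unset Printing Implicit Defensive.

Local Open Scope ring_scope.

(** * Sums over the supersets of a fixed set *)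

(** Complementation turns these sets into the subsets of [~: B] of size [#|T| - m]. Written this
    way, the binomial vanishes for [m < #|B|], where a truncated [m - #|B|] would give 1. *)
Lemma card_supersets (T : finType) (B : {set T}) (m : nat) : (m <= #|T|)%N ->
  #|[set A : {set T} | B \subset A & #|A| == m]%SET| = 'C(#|T| - #|B|, #|T| - m).
Proof.
move=> mT; have cardC (C : {set T}) : #|(~: C)%SET| = (#|T| - #|C|)%N.
  by rewrite cardsCs finset.setCK.
rewrite -cardC -cards_draws -(card_imset _ (@finset.setC_inj T)).
apply: eq_card => A; rewrite [RHS]inE; apply/imsetP/andP => [[C]|[AB /eqP Am]].
  by rewrite inE => /andP[BC /eqP Cm] ->; rewrite finset.setCS BC cardC Cm eqxx.
exists (~: A)%SET; last by rewrite finset.setCK.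
by rewrite inE finset.subsetC AB cardC Am subKn/=.
Qed.

Lemma sum_supersets (R : pzRingType) (T : finType) (B : {set T}) (g : nat -> R) :
  \sum_(A : {set T} | B \subset A) g #|A| =
  \sum_(#|B| <= m < #|T|.+1) 'C(#|T| - #|B|, m - #|B|)%:R * g m.
Proof.
rewrite (partition_big (fun A : {set T} => inord #|A| : 'I_#|T|.+1) xpredT)//=.
rewrite [RHS]big_geq_mkord; apply: esym; rewrite big_mkcond/=; apply: eq_bigr => m _.
rewrite (eq_bigl [in [set A : {set T} | B \subset A & #|A| == m]%SET]);
  last first.
  move=> A; rewrite inE; congr (_ && _).
  by rewrite -val_eqE/= inordK// ltnS max_card.
rewrite (eq_bigr (fun=> g m)); last by move=> A; rewrite inE => /andP[_ /eqP ->].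
have mT : (m <= #|T|)%N by rewrite -ltnS.
rewrite sumr_const card_supersets//.
(* Sizes below [#|B|] are absent from the range on the right; on the left their binomial is 0. *)
have BT := max_card B; case: leqP => Bm; last first.
  by rewrite bin_small ?mulr0n// ltn_sub2l// (leq_trans Bm BT).
by rewrite -[in LHS]bin_sub ?leq_sub2r// subnBA// subnK// mulr_natl.
Qed.

(** * Spectrum of a scalar matrix minus a constant one *)

(** For a row eigenvector [v] with coordinate sum [s], each coordinate gives
    [(l - z) * v_j = s * b]. If [s = 0], a nonzero coordinate forces [z = l]; otherwise sum over [j]
    and cancel [s]. *)
Lemma eigenvalue_scalar_const (F : fieldType) (n : nat) (l b z : F) :
  eigenvalue (l%:M - const_mx b : 'M[F]_n) z -> z = l \/ z = l - n%:R * b.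
Proof.
case/eigenvalueP => v; rewrite mulmxBr mul_mx_scalar => /rowP vz v0.
have {}vz j : (l - z) * v 0 j = (\sum_i v 0 i) * b.
  have := vz j; rewrite !mxE mulr_suml => /eqP; rewrite subr_eq => /eqP e.
  rewrite mulrBl e addrAC subrr add0r; apply: eq_bigr => i _; by rewrite mxE.
have [s0|s0] := eqVneq (\sum_i v 0 i) 0.
  left; apply/esym/eqP; rewrite -subr_eq0; apply: contraNT v0 => lz.
  apply/eqP/rowP => j; apply/eqP; rewrite mxE.
  by have /eqP := vz j; rewrite s0 mul0r mulf_eq0 (negPf lz).
right; apply/eqP; rewrite eq_sym subr_eq addrC -subr_eq; apply/eqP.
apply: (mulIf s0); rewrite mulr_sumr (eq_bigr _ (fun j _ => vz j)).
by rewrite sumr_const card_ord -mulr_natl; ring.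
Qed.

(** The difference of two basis vectors has sum zero, so the constant matrix kills it. *)
Lemma scalar_const_eigenvalue (F : fieldType) (n : nat) (l b : F) : (1 < n)%N ->
  eigenvalue (l%:M - const_mx b : 'M[F]_n) l.
Proof.
case: n => [|[|n]]// _; pose v : 'rV[F]_n.+2 := delta_mx 0 0 - delta_mx 0 (lift 0 0).
apply/eigenvalueP; exists v.
  rewrite mulmxBr mul_mx_scalar [X in _ - X](_ : _ = 0) ?subr0//.
  rewrite mulmxBl -!rowE; apply/rowP => j; by rewrite !mxE subrr.
apply/eqP => /rowP/(_ 0); rewrite !mxE !eqxx/= subr0 => /eqP; by rewrite oner_eq0.
Qed.

(* The sum of [p A / #|A| ^+ 2] over the sets [A] containing two given colours,
   when [p A = w #|A|]. *)
Definition pair_mass (R : realType) (n : nat) (w : nat -> R) : R :=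
  \sum_(2 <= m < n.+1) 'C(n - 2, m - 2)%:R * (w m / m%:R ^+ 2).

(** * Models whose probabilities depend on cardinality only *)

Section Exchangeable.
Variables (R : realType) (n : nat) (a : R) (w : nat -> R) (p : {set 'I_n} -> R).
Hypotheses (hn : (2 <= n)%N) (pE : forall A, p A = w #|A|).

Let c : R := n%:R^-1 `^ a.
Let n_neq0 : n%:R != 0 :> R.
Proof. by rewrite pnatr_eq0 -lt0n (leq_trans _ hn). Qed.
Let c_neq0 : c != 0.
Proof. by rewrite gt_eqF// powR_gt0// invr_gt0 ltr0n (leq_trans _ hn). Qed.
Let weightE A : weight a (barycenter R n) A = #|A|%:R * c.
Proof.
rewrite /weight (eq_bigr (fun=> c)) ?sumr_const ?mulr_natl// => j _.
by rewrite mxE.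
Qed.
Let card_neq0 (A : {set 'I_n}) i : i \in A -> #|A|%:R != 0 :> R.
Proof. by move=> iA; rewrite pnatr_eq0 (cardD1 i) iA. Qed.

(** At the barycenter colour [i] is selected with probability [S i], the sum of [p A / #|A|] over
    [A] containing [i]. By symmetry all [S i] agree, and they add up to 1, so each is [1/n]. *)
Lemma exchangeable_equilibrium : w 0 = 0 ->
  \sum_(m < n.+1) 'C(n, m)%:R * w m = 1 -> equilibrium p a (barycenter R n).
Proof.
move=> w0 w1; split.
  split=> [i|]; first by rewrite mxE invr_ge0 ler0n.
  under eq_bigr do rewrite mxE.
  by rewrite sumr_const card_ord -[LHS]mulr_natl divff.
pose S i : R := \sum_(A : {set 'I_n} | i \in A) p A / #|A|%:R.
have SE i j : S i = S j.
  have H k : S k = \sum_(1 <= m < n.+1) 'C(n - 1, m - 1)%:R * (w m / m%:R).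
    rewrite /S (eq_bigr (fun A : {set 'I_n} => w #|A| / #|A|%:R)); last first.
      by move=> A _; rewrite pE.
    rewrite (eq_bigl (fun A : {set 'I_n} => [set k]%SET \subset A)); last first.
      by move=> A; rewrite finset.sub1set.
    by rewrite (sum_supersets _ (fun m => w m / m%:R)) cards1 card_ord.
  by rewrite !H.
have sumS : \sum_i S i = 1.
  rewrite /S (exchange_big_dep xpredT)//= -[RHS]w1.
  have := sum_supersets (@finset.set0 'I_n) w.
  rewrite cards0 card_ord subn0 big_mkord.
  rewrite (eq_bigr (fun m : 'I_n.+1 => 'C(n, m)%:R * w m)); last first.
    by move=> m _; rewrite subn0.
  move=> <-; rewrite [RHS](eq_bigl xpredT); last first.
    by move=> A; rewrite finset.sub0set.
  apply: eq_bigr => A _; rewrite sumr_const -pE.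
  (* A nonempty [A] is counted [#|A|] times with weight [p A / #|A|]; the empty set is counted zero
     times, which matches [p A] only because [w 0 = 0]. *)
  have [->|[i iA]] := set_0Vmem A.
    by rewrite cards0 mulr0n pE cards0 w0.
  by rewrite -[LHS]mulr_natr mulfVK// (card_neq0 iA).
apply/rowP => i; rewrite !mxE.
rewrite (eq_bigr (fun A => p A / #|A|%:R)); last first.
  move=> A iA; rewrite weightE -/c; have := card_neq0 iA; move: c_neq0.
  by move=> ? ?; field; apply/andP.
rewrite -/(S i); apply: (mulfI n_neq0).
have : n%:R * S i = 1.
  rewrite -[RHS]sumS mulr_natl -[in LHS](card_ord n) -sumr_const.
  by apply: eq_bigr => j _; exact: SE.
by rewrite mulrDr => ->; rewrite mulrN divff// addNr mulr0.
Qed.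

Let T : R := pair_mass n w.

Let TE i k : i != k ->
  \sum_(A : {set 'I_n} | (i \in A) && (k \in A)) p A / #|A|%:R ^+ 2 = T.
Proof.
move=> ik; rewrite (eq_bigr (fun A : {set 'I_n} => w #|A| / #|A|%:R ^+ 2)); last first.
  by move=> A _; rewrite pE.
rewrite (eq_bigl (fun A : {set 'I_n} => [set i; k]%SET \subset A)); last first.
  by move=> A; rewrite finset.subUset !finset.sub1set.
by rewrite (sum_supersets _ (fun m => w m / m%:R ^+ 2)) cards2 ik card_ord.
Qed.

(** Double counting: a set [A] containing [i] contains [#|A| - 1] further colours [k], and each of
    the [n - 1] choices of [k] contributes [T]. *)
Let TdiagE i :
  \sum_(A : {set 'I_n} | i \in A) p A * (#|A|%:R - 1) / #|A|%:R ^+ 2 =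
  (n%:R - 1) * T.
Proof.
have -> : (n%:R - 1) * T = \sum_(k | k != i) T.
  by rewrite sumr_const cardC1 card_ord -[RHS]mulr_natl -subn1 natrB// ltnW.
rewrite (eq_bigr (fun k => \sum_(A : {set 'I_n} | (i \in A) && (k \in A))
    p A / #|A|%:R ^+ 2)); last first.
  by move=> k ki; rewrite TE// eq_sym.
rewrite (exchange_big_dep (fun A : {set 'I_n} => i \in A))/=; last first.
  by move=> k A _ /andP[].
apply: eq_bigr => A iA; rewrite (eq_bigl (fun k => k \in (A :\ i)%SET)); last first.
  by move=> k; rewrite !inE iA.
have cardA : #|A|%:R = #|(A :\ i)%SET|%:R + 1 :> R.
  by rewrite (cardsD1 i A) iA add1n -natr1.
by rewrite sumr_const cardA addrK -[RHS]mulr_natl mulrCA mulrA.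
Qed.

Lemma exchangeable_jacobian :
  jacobian p a (barycenter R n) =
  (-1 + a * (n%:R ^+ 2 * pair_mass n w))%:M - const_mx (a * (n%:R * pair_mass n w)).
Proof.
(* With this, all powers of [c] cancel: the diagonal entries become [-1 + a n (n - 1) T], the others
   [- a n T]. *)
have cE : n%:R^-1 `^ (a - 1) = c * n%:R.
  have v0 : 0 < n%:R^-1 :> R by rewrite invr_gt0 ltr0n (leq_trans _ hn).
  by rewrite powRB ?(gt_eqF v0) ?implybT// powRr1 ?ltW// invrK.
apply/matrixP => i k; rewrite !mxE -/c cE.
case: eqVneq => [_|ik]; rewrite ?mulr1n ?mulr0n.
  rewrite (eq_bigr (fun A : {set 'I_n} =>
      c^-1 * (p A * (#|A|%:R - 1) / #|A|%:R ^+ 2))).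
    rewrite -mulr_sumr TdiagE /T; field; exact: c_neq0.
  move=> A iA; rewrite weightE; field.
  by apply/andP; split => //; exact: card_neq0 iA.
rewrite (eq_bigr (fun A : {set 'I_n} => c ^- 2 * (p A / #|A|%:R ^+ 2))).
  rewrite -mulr_sumr TE// /T; field; exact: c_neq0.
move=> A /andP[iA _]; rewrite weightE; field.
by apply/andP; split => //; exact: card_neq0 iA.
Qed.

Let eigenvalue_cases z : jacobian_eigenvalue p a (barycenter R n) z ->
  z = real_complex R (-1 + a * (n%:R ^+ 2 * pair_mass n w)) \/ z = real_complex R (-1).
Proof.
rewrite /jacobian_eigenvalue exchangeable_jacobian map_mxB map_scalar_mx map_const_mx.
case/eigenvalue_scalar_const => ->; [by left|right].
(* In [l - n * b] the two terms [a n^2 T] cancel, leaving [-1]. *)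
rewrite -(rmorph_nat (real_complex R)) -rmorphM -rmorphB; congr (real_complex R _); ring.
Qed.

Let sum_zero_eigenvalue : jacobian_eigenvalue p a (barycenter R n)
  (real_complex R (-1 + a * (n%:R ^+ 2 * pair_mass n w))).
Proof.
rewrite /jacobian_eigenvalue exchangeable_jacobian map_mxB map_scalar_mx map_const_mx.
exact: scalar_const_eigenvalue.
Qed.

Lemma exchangeable_stableP :
  linearly_stable p a (barycenter R n) <-> a * (n%:R ^+ 2 * pair_mass n w) < 1.
Proof.
split=> [/(_ _ sum_zero_eigenvalue)/=|s z /eigenvalue_cases[]->/=]; lra.
Qed.

(** The eigenvalues are then 0 and [-1]: the first excludes stability, and neither is positive. *)
Lemma exchangeable_critical :
  a * (n%:R ^+ 2 * pair_mass n w) = 1 -> critical p a (barycenter R n).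
Proof.
move=> e; split=> [/exchangeable_stableP|[z /eigenvalue_cases[]->/=]]; lra.
Qed.

(** Common conclusion for every model with a finite threshold, which is the inverse of [n^2 T]. *)
Lemma exchangeable_threshold (th : R) : w 0 = 0 ->
  \sum_(m < n.+1) 'C(n, m)%:R * w m = 1 ->
  0 < th -> n%:R ^+ 2 * pair_mass n w = th^-1 ->
  [/\ equilibrium p a (barycenter R n),
      linearly_stable p a (barycenter R n) <-> a < th
    & a = th -> critical p a (barycenter R n)].
Proof.
move=> w0 w1 th0 thE; split; first exact: exchangeable_equilibrium.
  have -> : (a < th) = (a * (n%:R ^+ 2 * pair_mass n w) < 1).
    by rewrite thE ltr_pdivrMr// mul1r.
  exact: exchangeable_stableP.
by move=> ath; apply: exchangeable_critical; rewrite thE ath divff ?gt_eqF.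
Qed.

End Exchangeable.

(** * Pair masses and thresholds of the three models *)

Lemma uniform_pair_mass (R : realType) (n m : nat) :
  (2 <= n)%N -> (1 <= m <= n)%N ->
  n%:R ^+ 2 * pair_mass n (fun k => if k == m then ('C(n, m)%:R)^-1 else 0) =
  n%:R * (m%:R - 1) / (m%:R * (n%:R - 1)) :> R.
Proof.
move=> hn /andP[m0 mn]; rewrite /pair_mass.
have [m1|m1] := eqVneq m 1%N.
  rewrite big_nat big1 ?mulr0 ?m1 ?subrr ?mulr0 ?mul0r// => k /andP[k2 _].
  by rewrite gtn_eqF// mul0r mulr0.
have m2 : (2 <= m)%N by rewrite ltn_neqAle eq_sym m1.
rewrite (bigD1_seq m) ?iota_uniq ?mem_index_iota ?m2 ?ltnS//= eqxx big1 ?addr0;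
  last first.
  by move=> k /negPf ->; rewrite mul0r mulr0.
(* The absorption identity for binomials, applied twice. *)
have binE : (n * (n - 1) * 'C(n - 2, m - 2) = m * (m - 1) * 'C(n, m))%N.
  case: m n {m0 m1} m2 hn mn => [|[|m]]// [|[|n]]// _ _ _.
  rewrite !subSS !subn0 (mulnC m.+2) -(mulnA m.+1) -mul_bin_diag.
  by rewrite mulnCA -mul_bin_diag mulnA.
have {}binE : n%:R * (n%:R - 1) * 'C(n - 2, m - 2)%:R =
    m%:R * (m%:R - 1) * 'C(n, m)%:R :> R.
  have := congr1 (fun k : nat => k%:R : R) binE.
  by rewrite !natrM !natrB// ltnW.
have C0 : 'C(n, m)%:R != 0 :> R by rewrite pnatr_eq0 -lt0n bin_gt0.
have hm : m%:R != 0 :> R by rewrite pnatr_eq0 -lt0n.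
have hn1 : n%:R - 1 != 0 :> R by rewrite subr_eq0 (eqr_nat _ n 1) gtn_eqF.
have -> : n%:R ^+ 2 * ('C(n - 2, m - 2)%:R * ('C(n, m)%:R^-1 / m%:R ^+ 2)) =
    n%:R * (n%:R * (n%:R - 1) * 'C(n - 2, m - 2)%:R) /
      ('C(n, m)%:R * m%:R ^+ 2 * (n%:R - 1)) :> R.
  by field; rewrite C0 hm hn1.
by rewrite binE; field; rewrite C0 hm hn1.
Qed.

Lemma bernoulli_pair_mass (R : realType) (n : nat) (q : R) :
  n%:R ^+ 2 * pair_mass n (fun k => if k == 0%N then 0
     else q ^+ k * (1 - q) ^+ (n - k) / (1 - (1 - q) ^+ n)) =
  (bernoulli_threshold R n q)^-1.
Proof.
rewrite /bernoulli_threshold invf_div /pair_mass mulr_sumr mulr_suml.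
apply: eq_big_nat => -[|m]// _ /=; ring.
Qed.

Lemma bernoulli_threshold_gt0 (R : realType) (n : nat) (q : R) : (2 <= n)%N ->
  0 < q < 1 -> 0 < bernoulli_threshold R n q.
Proof.
move=> hn /andP[q0 q1]; have q'0 : 0 < 1 - q by rewrite subr_gt0.
have pos m : (2 <= m <= n)%N ->
  0 < q ^+ m * (1 - q) ^+ (n - m) * (n%:R ^+ 2 / m%:R ^+ 2) *
      'C(n - 2, m - 2)%:R.
  move=> /andP[m2 mn].
  by rewrite !mulr_gt0 ?invr_gt0 ?exprn_gt0 ?ltr0n ?bin_gt0 ?leq_sub2r// ltnW.
rewrite divr_gt0//.
  by rewrite subr_gt0 exprn_ilt1 ?ltW ?gtrBl// -lt0n ltnW.
rewrite big_ltn// ltr_pwDl ?pos//.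
by rewrite big_nat sumr_ge0// => m /andP[m3 mn]; rewrite ltW// pos// ltnW.
Qed.

(** Singletons contain no pair of colours, so only the full set contributes. *)
Lemma star_pair_mass (R : realType) (n : nat) : (2 <= n)%N ->
  n%:R ^+ 2 * pair_mass n (fun k =>
    if (k == 1%N) || (k == n) then n.+1%:R^-1 else 0) = n.+1%:R^-1 :> R.
Proof.
move=> hn; rewrite /pair_mass big_nat_recr//= eqxx orbT big_nat big1 ?add0r; last first.
  move=> m /andP[m2 mn]; by rewrite gtn_eqF// ltn_eqF//= mul0r mulr0.
by rewrite binn mul1r mulrCA divff ?mulr1// expf_neq0// pnatr_eq0 -lt0n ltnW.
Qed.

Theorem corollary1p19 (R : realType) (n : nat) (a : R)
    (hn : (2 <= n)%N) (ha : 1 < a) :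
  (forall m : nat, (1 <= m <= n)%N ->
     [/\ equilibrium (uniform_model R n m) a (barycenter R n),
         linearly_stable (uniform_model R n m) a (barycenter R n) <->
           (a%:E < uniform_threshold R n m)%E
       & a%:E = uniform_threshold R n m ->
           critical (uniform_model R n m) a (barycenter R n)]) /\
  (forall q : R, 0 < q < 1 ->
     [/\ equilibrium (bernoulli_model R n q) a (barycenter R n),
         linearly_stable (bernoulli_model R n q) a (barycenter R n) <->
           a < bernoulli_threshold R n q
       & a = bernoulli_threshold R n q ->
           critical (bernoulli_model R n q) a (barycenter R n)]) /\
  [/\ equilibrium (star_model R n) a (barycenter R n),
      linearly_stable (star_model R n) a (barycenter R n) <-> a < n.+1%:R
    & a = n.+1%:R -> critical (star_model R n) a (barycenter R n)].
Proof.
split; [move=> m hm|split=> [q hq|]].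
- pose w k : R := if k == m then ('C(n, m)%:R)^-1 else 0.
  have pE A : uniform_model R n m A = w #|A| by [].
  have /andP[m0 mn] := hm.
  have w0 : w 0%N = 0 by rewrite /w ltn_eqF.
  have w1 : \sum_(k < n.+1) 'C(n, k)%:R * w k = 1.
    rewrite (bigD1 (inord m)) //= /w inordK ?ltnS// eqxx divff ?big1 ?addr0//.
      move=> k; rewrite -val_eqE /= inordK ?ltnS// => /negPf ->.
      by rewrite mulr0.
    by rewrite pnatr_eq0 -lt0n bin_gt0.
  have massE := uniform_pair_mass R hn hm.
  rewrite /uniform_threshold; case: eqVneq => [m1|m1].
    (* For [m = 1] the pair mass is 0, so stability holds for every [a], and equality with [+oo] is
       impossible. *)
    split=> //; first exact: exchangeable_equilibrium pE w0 w1.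
    rewrite ltry; split=> // _; apply/(exchangeable_stableP _ hn pE).
    by rewrite massE m1 subrr mulr0 mul0r mulr0.
  have m2 : (2 <= m)%N by rewrite ltn_neqAle eq_sym m1.
  have th0 : 0 < m%:R * (n%:R - 1) / (n%:R * (m%:R - 1)) :> R.
    by rewrite divr_gt0 ?mulr_gt0 ?subr_gt0 ?ltr1n ?ltr0n// ltnW.
  have thE : n%:R ^+ 2 * pair_mass n w =
      (m%:R * (n%:R - 1) / (n%:R * (m%:R - 1)))^-1.
    by rewrite massE invf_div.
  have [? st cr] := exchangeable_threshold a hn pE w0 w1 th0 thE.
  by split; rewrite ?lte_fin// => -[/cr].
- pose w k : R := if k == 0%N then 0
    else q ^+ k * (1 - q) ^+ (n - k) / (1 - (1 - q) ^+ n).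
  apply: (@exchangeable_threshold R n a w) => //.
  + by move=> A; rewrite /bernoulli_model /w cards_eq0.
  + have /andP[q0 q1] := hq.
    have Z0 : 1 - (1 - q) ^+ n != 0.
      by rewrite gt_eqF// subr_gt0 exprn_ilt1 ?subr_ge0 ?ltW ?gtrBl// -lt0n ltnW.
    apply: (mulIf Z0); rewrite mul1r big_ord_recl /w/= mulr0 add0r mulr_suml.
    (* Restoring the missing term of the empty set completes the binomial expansion of
       [(1 - q + q) ^+ n]. *)
    apply: (addrI ((1 - q) ^+ n)); rewrite [RHS]addrC subrK.
    transitivity ((1 - q + q) ^+ n); last by rewrite subrK expr1n.
    rewrite [RHS]exprDn big_ord_recl subn0 expr0 mulr1 bin0 mulr1n.
    congr (_ + _); apply: eq_bigr => k _.
    rewrite mulrA mulfVK// -mulr_natl; ring.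
  + exact: bernoulli_threshold_gt0.
  + exact: bernoulli_pair_mass.
- pose w k : R := if (k == 1%N) || (k == n) then n.+1%:R^-1 else 0.
  apply: (@exchangeable_threshold R n a w) => //.
  + move=> A; rewrite /star_model /w.
    have An : (#|A| <= n)%N by rewrite -[leqRHS](card_ord n) max_card.
    by rewrite finset.eqEcard finset.subsetT cardsT card_ord (eqn_leq _ n) An.
  + by rewrite /w/= ltn_eqF// ltnW.
  (* Only sizes [n] and 1 count, giving [(n + 1) / (n + 1)]. Since [hn] also reads [1 < n],
     [Ordinal hn] is the index 1 of ['I_n]. *)
  + rewrite big_ord_recr/= (bigD1 (Ordinal hn))//= big1 ?addr0; last first.
      by move=> k /negPf k1; rewrite /w -val_eqE/= in k1 *; rewrite k1 ltn_eqF ?mulr0.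
    by rewrite /w !eqxx orbT/= bin1 binn -mulrDl natr1 divff// pnatr_eq0.
  + exact: star_pair_mass.
Qed.
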